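(* Let $X$ be a connected compact Hausdorff space with $|X|>1$ in which every point is a $G_\delta$ (thus each $\{p\}$ is a nowhere dense zero-set), and let $\mathcal{Z} = \{\{p\} \mid p \in X\}$. For each $Z\in\mathcal{Z}$ let $f_Z \in D(X)$ satisfy $f_Z \geq 1$ and $f_Z^{-1}(+\infty) = Z$. Let $\tau : Y \to X$ be a cover with $Y$ zero-dimensional, put $\tilde f_Z = f_Z\circ\tau \in D(Y)$ and $\tilde{\mathcal{Z}} = \{\tau^{-1}(Z) \mid Z \in \mathcal{Z}\}$, let $\tilde S$ be the linear span of $\{\tilde f_Z \mid Z \in \mathcal{Z}\}$ in $D(Y)$, and let $A = A(Y,\tilde{\mathcal{Z}}) = C(Y)+\tilde S$, with distinguished weak order unit the constant function $1$. Then $A$ has Yosida space $YA = Y$, which is zero-dimensional, and $\lambda A = \{\emptyset, Y\}$; thus the only projection bands of $A$ are $\{0\}$ and $A$, and $A$ fails SMP (sufficiently many projections).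
   Context: For compact Hausdorff $X$, $D(X)$ is the set of continuous $f : X \to \mathbb{R} \cup \{\pm\infty\}$ with $f^{-1}(\mathbb{R})$ dense in $X$; it is a lattice under pointwise order, closed under multiplication by real scalars, with addition only partially defined: $f+g=h$ in $D(X)$ means $h \in D(X)$ and $h(x)=f(x)+g(x)$ on the dense set where $f$ and $g$ are both finite. A cover is a continuous surjection $\tau: Y \to X$ of compact Hausdorff spaces that is irreducible: if $F \subseteq Y$ is closed and $F \neq Y$, then $\tau(F) \neq X$. Preimages under $\tau$ of nowhere dense sets are nowhere dense, so $f_Z \circ \tau \in D(Y)$. A space is zero-dimensional (ZD) if its clopen sets form a base. The linear span $\tilde S$ is the set of all finite sums $\sum_{i \in I} r_i \tilde f_{Z_i}$ with $r_i \in \mathbb{R}$ and $Z_i\in \mathcal{Z}$ distinct; these sums, and sums of members of $\tilde S$ with members of $C(Y)$, exist in $D(Y)$, and $A$ is an archimedean vector lattice in $D(Y)$ under these operations. A weak order unit of a vector lattice $A$ is $u>0$ such that $|a|\wedge u = 0$ implies $a=0$. For $(A,u)$ an archimedean vector lattice with distinguished weak order unit, the Yosida space $YA$ is the compact Hausdorff space of all ideals $M$ of $A$ maximal with respect to $u \notin M$, with the hull-kernel topology. The Yosida representation is a vector lattice isomorphism $\eta$ of $A$ onto a subset $\eta(A) \subseteq D(YA)$ (with all sums of elements of $\eta(A)$ existing in $D(YA)$ and lying in $\eta(A)$) with $\eta(u)=1$ and such that $\eta(A)$ 0-1 separates disjoint closed sets of $YA$ (for disjoint closed $E,F$ some element is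 $0$ on $E$ and $1$ on $F$). For a vector lattice $A \subseteq D(Y)$ containing the constant $1$ as distinguished unit, ''$YA = Y$'' means that the inclusion $A \subseteq D(Y)$ is the Yosida representation of $A$, up to a homeomorphism of $Y$ with $YA$. For $a \in A$ and a clopen set $U$, $a\chi(U)$ is the function equal to $a$ on $U$ and $0$ off $U$. $\lambda A$ is the family of all clopen $U \subseteq YA$ such that $a\chi(U) \in A$ for every $a \in A$. A band in $A$ is an ideal closed under existing suprema of subsets of its elements; a projection band is a band $B$ for which $A = B \oplus B'$ for some band $B' \subseteq A$. $A$ has sufficiently many projections (SMP) if each nonzero band contains a nonzero projection band. *)

(* Defs.v *)
From HB Require Import structures.
From mathcomp Require Import all_boot all_order all_algebra.
From mathcomp Require Import all_classical all_reals.
From mathcomp Require Import ereal topology normedtype borel_hierarchy.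

Set Implicit Arguments.
Unset Strict Implicit.
Unset Printing Implicit Defensive.

Import Order.TTheory GRing.Theory Num.Theory.
Import numFieldNormedType.Exports.
Local Open Scope classical_set_scope.
Local Open Scope ring_scope.

(* The lattice operations are fields of the mixin, and not inherited from
   Order.Lattice: Hierarchy-Builder has no join of Order.Lattice with the
   additive structures below realDomainType. *)
HB.mixin Record isVectorLattice (R : realType) V
    of GRing.Lmodule R V & Num.POrderedZmodule V := {
  vmeet : V -> V -> V;
  vjoin : V -> V -> V;
  vmeetP : forall x y z : V, (x <= vmeet y z) = (x <= y) && (x <= z);
  vjoinP : forall x y z : V, (vjoin x y <= z) = (x <= z) && (y <= z);
  vl_leD2r : forall z x y : V, x <= y -> x + z <= y + z;
  vl_scale_ge0 : forall (r : R) (x : V), 0 <= r -> 0 <= x -> 0 <= r *: x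
}.

#[short(type="vectorLatticeType")]
HB.structure Definition VectorLattice (R : realType) :=
  { V of isVectorLattice R V & GRing.Lmodule R V & Num.POrderedZmodule V }.

Arguments vl_leD2r {R s} z {x y}.
Arguments vl_scale_ge0 {R s r x}.

Section VectorLatticeTheory.
Context {R : realType} {V : vectorLatticeType R}.
Implicit Types (a b u x y z : V) (r k : R) (B I J M : set V).

Definition labs a : V := vjoin a (- a).

Definition archimedean_vl : Prop :=
  forall a b, 0 <= a -> (forall n, a *+ n <= b) -> a = 0.

Definition weak_order_unit u : Prop :=
  0 < u /\ forall a, vmeet (labs a) u = 0 -> a = 0.

Record is_ideal I : Prop := IsIdeal {
  ideal0 : I 0;
  idealD : forall a b, I a -> I b -> I (a + b);
  idealZ : forall r a, I a -> I (r *: a);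
  ideal_solid : forall a b, I a -> labs b <= labs a -> I b }.

Definition is_band B : Prop :=
  is_ideal B /\
  forall (S : set V) x, S `<=` B -> supremums S x -> B x.

Definition direct_sum B B' : Prop :=
  (forall a, exists b b', [/\ B b, B' b' & a = b + b']) /\
  B `&` B' = [set 0].

Definition projection_band B : Prop :=
  is_band B /\ exists B', is_band B' /\ direct_sum B B'.

Definition SMP : Prop :=
  forall B, is_band B -> B <> [set 0] ->
  exists P, [/\ projection_band P, P <> [set 0] & P `<=` B].

Definition maximal_avoiding u M : Prop :=
  [/\ is_ideal M, ~ M u &
      forall J, is_ideal J -> ~ J u -> M `<=` J -> J = M].

Lemma vmeet_lel x y : vmeet x y <= x.
Proof. by have := vmeetP (vmeet x y) x y; rewrite lexx => /esym/andP[]. Qed.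

Lemma vmeet_ler x y : vmeet x y <= y.
Proof. by have := vmeetP (vmeet x y) x y; rewrite lexx => /esym/andP[]. Qed.

Lemma vl_leD x y z t : x <= y -> z <= t -> x + z <= y + t.
Proof.
move=> xy zt; have h := vl_leD2r z xy; apply: (le_trans h).
by rewrite ![y + _]addrC; exact: vl_leD2r.
Qed.

Lemma vl_lesub x y z : (x <= y + z) = (x - y <= z).
Proof.
apply/idP/idP => [/(vl_leD2r (- y))|/(vl_leD2r y)].
  by rewrite [y + z]addrC addrK.
by rewrite subrK addrC.
Qed.

Lemma vl_leZ r x y : 0 <= r -> x <= y -> r *: x <= r *: y.
Proof.
move=> r0 xy; have := vl_leD2r (- x) xy; rewrite subrr => yx.
have := vl_scale_ge0 r0 yx; rewrite scalerBr => /(vl_leD2r (r *: x)).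
by rewrite add0r subrK.
Qed.

Lemma labs_le x z : (labs x <= z) = (x <= z) && (- x <= z).
Proof. exact: vjoinP. Qed.

Lemma le_labs x : x <= labs x. Proof. by have := vjoinP x (- x) (labs x); rewrite lexx => /esym/andP[]. Qed.

Lemma le_labsN x : - x <= labs x. Proof. by have := vjoinP x (- x) (labs x); rewrite lexx => /esym/andP[]. Qed.

Lemma labs_ge0 x : 0 <= labs x.
Proof.
have := vl_leD (le_labs x) (le_labsN x); rewrite subrr => h.
have h2 : 0 <= (2%:R : R)^-1 by rewrite invr_ge0 ler0n.
have e : (2%:R : R)^-1 + 2%:R^-1 = 1.
  by rewrite -mulr2n -(mulr_natr (2%:R^-1 : R) 2) mulVf// pnatr_eq0.
by have := vl_leZ h2 h; rewrite scaler0 scalerDr -scalerDl e scale1r.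
Qed.

Lemma ger0_labs x : 0 <= x -> labs x = x.
Proof.
move=> x0; apply/le_anti; rewrite le_labs andbT labs_le lexx /=.
have := vl_leD2r (- x) x0; rewrite add0r subrr => h; exact: le_trans h x0.
Qed.

Lemma labs_id x : labs (labs x) = labs x.
Proof. exact/ger0_labs/labs_ge0. Qed.

Lemma labsD x y : labs (x + y) <= labs x + labs y.
Proof.
by rewrite labs_le opprD !vl_leD// ?le_labs// le_labsN.
Qed.

Lemma labsZ r x : labs (r *: x) <= `|r| *: labs x.
Proof.
rewrite labs_le; have [r0|r0] := leP 0 r.
  rewrite ger0_norm// -scalerN; apply/andP; split.
    by apply: vl_leZ => //; exact: le_labs.
  by apply: vl_leZ => //; exact: le_labsN.
have r0' : 0 <= - r by rewrite oppr_ge0 ltW.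
have -> : r *: x = - r *: - x by rewrite scaleNr scalerN opprK.
rewrite ltr0_norm// -scalerN opprK.
apply/andP; split; apply: vl_leZ => //; [exact: le_labsN | exact: le_labs].
Qed.

Lemma ideal_labs I a : is_ideal I -> I a -> I (labs a).
Proof. by move=> II Ia; apply: (ideal_solid II Ia); rewrite labs_id. Qed.

Lemma ideal_le I a b : is_ideal I -> I a -> labs b <= a -> I b.
Proof.
by move=> II Ia ba; apply: (ideal_solid II Ia); exact: le_trans (le_labs _).
Qed.

Lemma maximal_avoiding_gen u M s : maximal_avoiding u M -> ~ M s ->
  exists m k, [/\ M m, 0 <= m, 0 <= k & labs u <= m + k *: labs s].
Proof.
move=> [IM Mu Mmax] Ms; apply: contrapT => nu.
pose J : set V :=
  [set x | exists m k, [/\ M m, 0 <= m, 0 <= k & labs x <= m + k *: labs s]].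
have IJ : is_ideal J.
  split.
  - exists 0, 0; split => //; first exact: ideal0.
    by rewrite scale0r addr0 labs_le oppr0 lexx.
  - move=> a b [m [k [Mm m0 k0 am]]] [m' [k' [Mm' m'0 k'0 bm]]].
    exists (m + m'), (k + k'); split; [exact: idealD | | exact: addr_ge0 |].
      by rewrite -[0](addr0 0); exact: vl_leD.
    by rewrite scalerDl addrACA (le_trans (labsD _ _))// vl_leD.
  - move=> r a [m [k [Mm m0 k0 am]]]; exists (`|r| *: m), (`|r| * k).
    split; [exact: idealZ | exact: vl_scale_ge0 | exact: mulr_ge0 |].
    rewrite (le_trans (labsZ _ _))// -scalerA -scalerDr.
    exact: vl_leZ.
  - move=> a b [m [k [Mm m0 k0 am]]] ba; exists m, k; split => //.
    exact: le_trans ba am.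
have MJ : M `<=` J.
  move=> x Mx; exists (labs x), 0; split => //; first exact: ideal_labs.
    exact: labs_ge0.
  by rewrite scale0r addr0.
have JM := Mmax J IJ nu MJ; apply: Ms.
rewrite -JM; exists 0, 1; split => //; first exact: ideal0.
by rewrite scale1r add0r.
Qed.

Lemma maximal_avoiding_prime u M s t : maximal_avoiding u M ->
  M (vmeet (labs s) (labs t)) -> M s \/ M t.
Proof.
move=> Mu Mst; apply: contrapT => /not_orP[Ms Mt].
have [m [k [Mm m0 k0 um]]] := maximal_avoiding_gen Mu Ms.
have [m' [k' [Mm' m'0 k'0 um']]] := maximal_avoiding_gen Mu Mt.
have [IM nMu _] := Mu; apply: nMu.
pose K := k + k' + 1; pose n := m + m'.
have Kgt0 : 0 < K by rewrite ltr_wpDl// addr_ge0.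
have K0 : 0 <= K := ltW Kgt0.
have key x j p : 0 <= p -> M p -> labs u <= p + j *: labs x ->
    j <= K -> p <= n -> K^-1 *: (labs u - n) <= labs x.
  move=> p0 Mp ux jK pn.
  have KV : 0 <= K^-1 by rewrite invr_ge0.
  suff h : labs u - n <= K *: labs x.
    have := vl_leZ KV h; rewrite scalerA mulVf ?scale1r//.
    by rewrite gt_eqF.
  rewrite -vl_lesub (le_trans ux)// vl_leD//.
  have := vl_scale_ge0 (_ : 0 <= K - j) (labs_ge0 x).
  rewrite subr_ge0 => /(_ jK); rewrite scalerBl => /(vl_leD2r (j *: labs x)).
  by rewrite add0r subrK.
have hs : K^-1 *: (labs u - n) <= labs s.
  apply: (key _ _ _ m0 Mm um).
    by rewrite /K -addrA ler_wpDr// addr_ge0.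
  by rewrite /n -[X in X <= _]addr0; exact: vl_leD.
have ht : K^-1 *: (labs u - n) <= labs t.
  apply: (key _ _ _ m'0 Mm' um').
    by rewrite /K addrAC ler_wpDl// addr_ge0.
  by rewrite /n -[X in X <= _]add0r; exact: vl_leD.
have h : K^-1 *: (labs u - n) <= vmeet (labs s) (labs t).
  by rewrite vmeetP hs ht.
apply: (@ideal_le M (n + K *: vmeet (labs s) (labs t)) _ IM).
  by apply: (idealD IM); [exact: idealD | exact: idealZ].
rewrite vl_lesub; have := vl_leZ K0 h.
by rewrite scalerA mulfV ?gt_eqF// scale1r.
Qed.

End VectorLatticeTheory.

Arguments archimedean_vl {R} V.
Arguments SMP {R} V.

Record yosida (R : realType) (V : vectorLatticeType R) (u : V) := Yosida {
  yosida_ideal :> set V;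
  yosidaP : maximal_avoiding u yosida_ideal }.

Section YosidaTopology.
Context {R : realType} {V : vectorLatticeType R} {u : V}.
Notation YA := (yosida u).

HB.instance Definition _ := gen_eqMixin YA.
HB.instance Definition _ := gen_choiceMixin YA.

(* The closed sets are the hulls [set M | S `<=` M], for S : set V. *)
Definition hull_kernel_open : set (set YA) :=
  [set U | exists S : set V, U = [set M : YA | ~ (S `<=` (M : set V))]].

Lemma hull_kernel_openT : hull_kernel_open setT.
Proof.
exists [set u]; apply/seteqP; split => // M _ /(_ u erefl).
by case: (yosidaP M).
Qed.

Lemma hull_kernel_openI : setI_closed hull_kernel_open.
Proof.
move=> _ _ [S ->] [T ->].
exists [set vmeet (labs s) (labs t) | s in S & t in T].
apply/seteqP; split => M /=.
  move=> [/existsNP[s /not_implyP[Ss Ms]] /existsNP[t /not_implyP[Tt Mt]]] STM.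
  have /(maximal_avoiding_prime (yosidaP M))[] // :
    (M : set V) (vmeet (labs s) (labs t)).
  by apply: STM; exists s => //; exists t.
have [IM _ _] := yosidaP M.
move=> /existsNP[_ /not_implyP[[s Ss [t Tt <-]] Mst]].
have p0 : 0 <= vmeet (labs s) (labs t) by rewrite vmeetP !labs_ge0.
split=> SM; apply: Mst.
- apply: (ideal_le IM (ideal_labs IM (SM _ Ss))).
  by rewrite ger0_labs// vmeet_lel.
- apply: (ideal_le IM (ideal_labs IM (SM _ Tt))).
  by rewrite ger0_labs// vmeet_ler.
Qed.

Lemma hull_kernel_open_bigU (I : Type) (f : I -> set YA) :
  (forall i, hull_kernel_open (f i)) -> hull_kernel_open (\bigcup_i f i).
Proof.
move=> fo.
exists [set v | exists i S, f i = [set M : YA | ~ (S `<=` (M : set V))] /\ S v].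
apply/seteqP; split => M /=.
  move=> [i _]; have [S fS] := fo i; rewrite fS /= => SM h; apply: SM => v Sv.
  by apply: h; exists i, S.
move=> /existsNP[v /not_implyP[[i [S [fS Sv]]] Mv]]; exists i => //.
by rewrite fS => /(_ v Sv).
Qed.

HB.instance Definition _ := isOpenTopological.Build YA
  hull_kernel_openT hull_kernel_openI hull_kernel_open_bigU.

End YosidaTopology.

Record dfun (R : realType) (X : topologicalType) := DFun {
  dfun_val :> X -> \bar R;
  dfun_continuous : continuous dfun_val;
  dfun_dense : dense [set x | dfun_val x \is a fin_num] }.

Section DFun.
Context {R : realType} {X : topologicalType}.
Implicit Types (f g h : dfun R X) (r : R).
Local Open Scope ereal_scope.

Lemma dfunP f g : f =1 g -> f = g.
Proof.
case: f g => [f cf df] [g cg dg] /= /funext fg; subst g.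
by congr DFun; exact: Prop_irrelevance.
Qed.

Lemma open_fin_num : open [set x : \bar R | x \is a fin_num].
Proof.
rewrite (_ : [set _ | _] = [set x | x < +oo] `&` [set x | -oo < x]).
  by apply: openI; [exact: open_ereal_lt_ereal | exact: open_ereal_gt_ereal].
by apply/seteqP; split => x /=; rewrite fin_numElt andbC => /andP.
Qed.

Lemma open_dfun_fin f : open [set x | f x \is a fin_num].
Proof.
apply: (@open_comp _ _ f [set y : \bar R | y \is a fin_num]) open_fin_num.
by move=> x _; exact: dfun_continuous.
Qed.

Lemma dense_dfun_fin2 f g :
  dense [set x | f x \is a fin_num /\ g x \is a fin_num].
Proof.
exact: (denseI (open_dfun_fin f) (@dfun_dense _ _ f) (@dfun_dense _ _ g)).
Qed.

Lemma dense_dfun_fin3 f g h :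
  dense [set x | [/\ f x \is a fin_num, g x \is a fin_num & h x \is a fin_num]].
Proof.
have := denseI (open_dfun_fin f) (@dfun_dense _ _ f) (dense_dfun_fin2 g h).
by apply: contraPP => h1 h2; apply: h1 => O O0 oO;
  have [x [Ox [fx [gx hx]]]] := h2 O O0 oO; exists x.
Qed.

Lemma dfun_eq_dense f g (S : set X) :
  dense S -> (forall x, S x -> f x = g x) -> f = g.
Proof.
move=> dS fg; apply: dfunP => x; apply: contrapT => /eqP fgx.
have := @ereal_hausdorff R; rewrite open_hausdorff => /(_ _ _ fgx).
move=> [[A B] /= [/set_mem Af /set_mem Bg] [oA oB /eqP AB]].
have oAB : open (f @^-1` A `&` g @^-1` B).
  by apply: openI; apply: open_comp => // y _; exact: dfun_continuous.
have [y [[/= Ay By] Sy]] := dS _ (ex_intro _ x (conj Af Bg)) oAB.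
have : (A `&` B) (f y) by split => //; rewrite fg.
by rewrite AB.
Qed.

HB.instance Definition _ := gen_eqMixin (dfun R X).
HB.instance Definition _ := gen_choiceMixin (dfun R X).

Definition dle f g : bool := `[< forall x, f x <= g x >].

Lemma dle_refl : reflexive dle.
Proof. by move=> f; apply/asboolP. Qed.

Lemma dle_anti : antisymmetric dle.
Proof.
move=> f g /andP[/asboolP fg /asboolP gf]; apply: dfunP => x.
by apply/le_anti; rewrite fg gf.
Qed.

Lemma dle_trans : transitive dle.
Proof.
move=> g f h /asboolP fg /asboolP gh; apply/asboolP => x.
exact: le_trans (fg x) (gh x).
Qed.

HB.instance Definition _ := Order.Le_isPOrder.Build ring_display (dfun R X)
  dle_refl dle_anti dle_trans.

Lemma dmax_dense f g : dense [set x | maxe (f x) (g x) \is a fin_num].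
Proof.
move=> O O0 oO; have [x [Ox [fx gx]]] := dense_dfun_fin2 f g O0 oO.
by exists x; split => //=; rewrite /maxe; case: ifP.
Qed.

Lemma dmin_dense f g : dense [set x | mine (f x) (g x) \is a fin_num].
Proof.
move=> O O0 oO; have [x [Ox [fx gx]]] := dense_dfun_fin2 f g O0 oO.
by exists x; split => //=; rewrite /mine; case: ifP.
Qed.

Definition dmax f g : dfun R X :=
  DFun (max_fun_continuous (@dfun_continuous _ _ f) (@dfun_continuous _ _ g))
       (@dmax_dense f g).

Definition dmin f g : dfun R X :=
  DFun (min_fun_continuous (@dfun_continuous _ _ f) (@dfun_continuous _ _ g))
       (@dmin_dense f g).

Lemma dminP f g h : dle f (dmin g h) = dle f g && dle f h.
Proof.
apply/asboolP/andP => [fgh|[/asboolP fg /asboolP fh] x]; last first.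
  by rewrite /= le_min fg fh.
by split; apply/asboolP => x; have := fgh x; rewrite /= le_min => /andP[].
Qed.

Lemma dmaxP f g h : dle (dmax f g) h = dle f h && dle g h.
Proof.
apply/asboolP/andP => [fgh|[/asboolP fg /asboolP fh] x]; last first.
  by rewrite /= ge_max fg fh.
by split; apply/asboolP => x; have := fgh x; rewrite /= ge_max => /andP[].
Qed.

HB.instance Definition _ :=
  Order.POrder_MeetJoin_isLattice.Build ring_display (dfun R X) dminP dmaxP.

Lemma dcst_dense r : dense [set x : X | (fun=> r%:E) x \is a fin_num].
Proof. by move=> O [x Ox] _; exists x. Qed.

Definition dcst r : dfun R X := DFun (@cst_continuous X (\bar R) r%:E) (dcst_dense r).

Lemma dscale_continuous r f : continuous (fun x => r%:E * f x).
Proof.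
move=> x; apply: (@continuous_comp _ _ _ f (mule r%:E)).
  exact: dfun_continuous.
exact: mule_continuous.
Qed.

Lemma dscale_dense r f : dense [set x | r%:E * f x \is a fin_num].
Proof.
move=> O O0 oO; have [x [Ox /= fx]] := @dfun_dense _ _ f O O0 oO.
by exists x; split => //=; rewrite fin_numM.
Qed.

Definition dscale r f : dfun R X :=
  DFun (@dscale_continuous r f) (@dscale_dense r f).

(* "f + g = h in D(X)"; addition on D(X) is only partially defined. *)
Definition dadd f g h : Prop :=
  forall x, f x \is a fin_num -> g x \is a fin_num -> h x = f x + g x.

Fixpoint dsum (s : seq (dfun R X)) (h : dfun R X) : Prop :=
  if s is f :: s' then exists2 g, dsum s' g & dadd f g h else h = dcst 0.

Definition Cfun : set (dfun R X) :=
  [set h | exists2 g : X -> R, continuous g & forall x, h x = (g x)%:E].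

Lemma dle_dense f g (S : set X) :
  dense S -> (forall x, S x -> f x <= g x) -> dle f g.
Proof.
move=> dS fg; have <- : dmax f g = g.
  by apply: (dfun_eq_dense dS) => x Sx /=; apply/max_idPr; exact: fg.
by apply/asboolP => x /=; rewrite le_max lexx.
Qed.

Record vlattice_in (A : set (dfun R X)) : Prop := VLatticeIn {
  vlin1 : A (dcst 1);
  vlinD : forall f g, A f -> A g -> exists h, A h /\ dadd f g h;
  vlinZ : forall r f, A f -> A (dscale r f);
  vlin_meet : forall f g, A f -> A g -> A (Order.meet f g);
  vlin_join : forall f g, A f -> A g -> A (Order.join f g) }.

End DFun.

Arguments Cfun R X : clear implicits.

(* HA is an index of the type: the sum of two elements is the one given by
   vlinD, which is unique because elements of D(X) agreeing on a dense set are
   equal. *)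
Record vl_of (R : realType) (X : topologicalType) (A : set (dfun R X))
    (HA : vlattice_in A) := VLOf {
  vl_val :> dfun R X;
  vl_valP : A vl_val }.

Section VLOf.
Context {R : realType} {X : topologicalType} {A : set (dfun R X)}.
Variable HA : vlattice_in A.
Notation V := (vl_of HA).
Implicit Types (a b c : V) (r : R).

Lemma vl_inj a b : (a : dfun R X) = b -> a = b.
Proof.
case: a b => [a Aa] [b Ab] /= ab; subst b.
by congr VLOf; exact: Prop_irrelevance.
Qed.

HB.instance Definition _ := gen_eqMixin V.
HB.instance Definition _ := gen_choiceMixin V.

Definition vl_scale r a : V := VLOf HA (vlinZ HA r (vl_valP a)).

Lemma vlin0 : A (dcst 0).
Proof.
have -> : dcst 0 = dscale 0 (dcst 1) :> dfun R X.
  by apply: dfunP => x /=; rewrite mul0e.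
by apply: (vlinZ HA); exact: vlin1.
Qed.

Definition vl_zero : V := VLOf HA vlin0.

Definition vl_one : V := VLOf HA (vlin1 HA).

Definition vl_opp a : V := vl_scale (-1) a.

Definition vl_add a b : V :=
  let h := cid (vlinD HA (vl_valP a) (vl_valP b)) in
  VLOf HA (proj1 (projT2 h)).

Lemma vl_addP a b : dadd a b (vl_add a b).
Proof. by rewrite /vl_add /=; case: cid => h []. Qed.

Arguments vl_add : simpl never.

Lemma vl_addE a b (x : X) : a x \is a fin_num -> b x \is a fin_num ->
  vl_add a b x = (a x + b x)%E.
Proof. exact: vl_addP. Qed.

Lemma vl_addA : associative vl_add.
Proof.
move=> a b c; apply/vl_inj/(dfun_eq_dense (dense_dfun_fin3 a b c)).
by move=> x [ax bx cx]; rewrite !vl_addE ?fin_numD ?ax ?bx// addeA.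
Qed.

Lemma vl_addC : commutative vl_add.
Proof.
move=> a b; apply/vl_inj/(dfun_eq_dense (dense_dfun_fin2 a b)).
by move=> x [ax bx]; rewrite !vl_addE// addeC.
Qed.

Lemma vl_add0 : left_id vl_zero vl_add.
Proof.
move=> a; apply/vl_inj/(dfun_eq_dense (@dfun_dense _ _ a)).
by move=> x ax; rewrite !vl_addE// add0e.
Qed.

Lemma vl_addN : left_inverse vl_zero vl_opp vl_add.
Proof.
move=> a; apply/vl_inj/(dfun_eq_dense (@dfun_dense _ _ a)) => x ax.
by rewrite vl_addE ?fin_numM//= mulN1e addeC subee.
Qed.

HB.instance Definition _ :=
  GRing.isZmodule.Build V vl_addA vl_addC vl_add0 vl_addN.

Lemma vlDE a b (x : X) : a x \is a fin_num -> b x \is a fin_num ->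
  (a + b) x = (a x + b x)%E.
Proof. exact: vl_addE. Qed.

Lemma vl_scaleA r s a : vl_scale r (vl_scale s a) = vl_scale (r * s) a.
Proof. by apply/vl_inj/dfunP => x /=; rewrite EFinM muleA. Qed.

Lemma vl_scale1 : left_id 1 vl_scale.
Proof. by move=> a; apply/vl_inj/dfunP => x /=; rewrite mul1e. Qed.

Lemma vl_scaleDr : right_distributive vl_scale +%R.
Proof.
move=> r a b; apply/vl_inj/(dfun_eq_dense (dense_dfun_fin2 a b)).
move=> x [ax bx]; rewrite vlDE/= ?fin_numM// vlDE//.
by rewrite -muleDr// fin_num_adde_defl.
Qed.

Lemma vl_scaleDl a : {morph vl_scale^~ a : r s / r + s}.
Proof.
move=> r s; apply/vl_inj/(dfun_eq_dense (@dfun_dense _ _ a)) => x ax.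
rewrite vlDE ?fin_numM//=.
by rewrite -[a x]fineK// -!EFinM -!EFinD mulrDl.
Qed.

HB.instance Definition _ :=
  GRing.Zmodule_isLmodule.Build R V vl_scaleA vl_scale1 vl_scaleDr vl_scaleDl.

Definition vl_le a b : bool := (a : dfun R X) <= b.

Lemma vl_le_refl : reflexive vl_le.
Proof. by move=> a; exact: lexx. Qed.

Lemma vl_le_anti : antisymmetric vl_le.
Proof. by move=> a b ab; apply: vl_inj; exact: le_anti. Qed.

Lemma vl_le_trans : transitive vl_le.
Proof. by move=> b a c; exact: le_trans. Qed.

HB.instance Definition _ := Order.Le_isPOrder.Build ring_display V
  vl_le_refl vl_le_anti vl_le_trans.

Definition vl_meet a b : V := VLOf HA (vlin_meet HA (vl_valP a) (vl_valP b)).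
Definition vl_join a b : V := VLOf HA (vlin_join HA (vl_valP a) (vl_valP b)).

Lemma vl_meetP a b c : vl_le a (vl_meet b c) = vl_le a b && vl_le a c.
Proof. by rewrite /vl_le lexI. Qed.

Lemma vl_joinP a b c : vl_le (vl_join a b) c = vl_le a c && vl_le b c.
Proof. by rewrite /vl_le leUx. Qed.

Lemma vl_of_leD2r c a b : a <= b -> a + c <= b + c.
Proof.
move=> /asboolP ab; apply: (dle_dense (dense_dfun_fin3 a b c)).
by move=> x [ax bx cx]; rewrite !vlDE// leeD2r.
Qed.

Lemma vl_of_scale_ge0 r a : 0 <= r -> 0 <= a -> 0 <= r *: a.
Proof.
move=> r0 /asboolP a0; apply/asboolP => x /=; rewrite mule_ge0//.
exact: a0.
Qed.

HB.instance Definition _ :=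
  isVectorLattice.Build R V vl_meetP vl_joinP vl_of_leD2r vl_of_scale_ge0.

End VLOf.

Record yosida_representation (R : realType) (V : vectorLatticeType R) (u : V)
    (eta : V -> dfun R (yosida u)) : Prop := YosidaRepresentation {
  yrep_inj : injective eta;
  yrepD : forall a b, dadd (eta a) (eta b) (eta (a + b));
  yrepZ : forall (r : R) a, eta (r *: a) = dscale r (eta a);
  yrep_meet : forall a b, eta (vmeet a b) = Order.meet (eta a) (eta b);
  yrep_join : forall a b, eta (vjoin a b) = Order.join (eta a) (eta b);
  yrep_unit : eta u = dcst 1;
  yrep_sep : forall E F : set (yosida u), closed E -> closed F ->
    E `&` F = set0 ->
    exists a, (forall M, E M -> eta a M = 0%E) /\
              (forall M, F M -> eta a M = 1%E) }.

Definition homeomorphism (S T : topologicalType) (h : S -> T) : Prop :=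
  continuous h /\
  exists k : T -> S, [/\ continuous k, cancel h k & cancel k h].

(* "YA = Y" for A in D(Y), with distinguished unit the constant 1. *)
Definition yosida_space_is (R : realType) (Y : topologicalType)
    (A : set (dfun R Y)) (HA : vlattice_in A) : Prop :=
  exists h : Y -> yosida (vl_one HA), homeomorphism h /\
  exists eta : vl_of HA -> dfun R (yosida (vl_one HA)),
    yosida_representation eta /\ forall a y, eta a (h y) = a y.

(* For A in D(Y) with YA = Y; the clopen sets range over Y itself. *)
Definition lambda (R : realType) (Y : topologicalType) (A : set (dfun R Y)) :
    set (set Y) :=
  [set U | clopen U /\ forall a, A a ->
     exists2 b, A b & forall y, b y = if y \in U then a y else 0%E].

Definition nowhere_dense (X : topologicalType) (S : set X) : Prop :=
  interior (closure S) = set0.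

Definition zero_set (R : realType) (X : topologicalType) (S : set X) : Prop :=
  exists2 g : X -> R, continuous g & S = g @^-1` [set 0].

(* Not the library's zero_dimensional, which asks that points be separated by
   clopen sets. *)
Definition clopen_base (X : topologicalType) : Prop := basis (@clopen X).

Record is_cover (X Y : topologicalType) (tau : Y -> X) : Prop := IsCover {
  cover_compact_cod : compact [set: X];
  cover_hausdorff_cod : hausdorff_space X;
  cover_compact_dom : compact [set: Y];
  cover_hausdorff_dom : hausdorff_space Y;
  cover_continuous : continuous tau;
  cover_surj : forall x, exists y, tau y = x;
  cover_irreducible : forall F : set Y,
    closed F -> F <> setT -> tau @` F <> setT }.

Arguments zero_set R {X} S.

Section Cover.
Context {R : realType} {X Y : topologicalType} (tau : Y -> X).
Hypothesis Htau : is_cover tau.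

Lemma cover_dense_preimage (S : set X) : dense S -> dense (tau @^-1` S).
Proof.
move=> dS O [y0 Oy0] oO.
have cO : closed (~` O) by exact: open_closedC.
have nO : ~` O <> setT.
  by move=> OT; have : (~` O) y0 by rewrite OT.
have ctF : closed (tau @` (~` O)).
  apply: (compact_closed (cover_hausdorff_cod Htau)).
  apply: continuous_compact.
    by apply: continuous_subspaceT; exact: cover_continuous.
  exact: (subclosed_compact cO (cover_compact_dom Htau)).
have /existsNP[x Fx] : ~ (forall x, (tau @` (~` O)) x).
  by move=> h; apply: (cover_irreducible Htau cO nO); apply/seteqP; split.
have [z [nFz Sz]] := dS _ (ex_intro _ x Fx) (closed_openC ctF).
have [y yz] := cover_surj Htau z; exists y; split; last by rewrite /= yz.
by apply: contrapT => nOy; apply: nFz; exists y.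
Qed.

Lemma dcomp_continuous (f : dfun R X) : continuous (f \o tau).
Proof.
move=> y; apply: continuous_comp; last exact: dfun_continuous.
exact: cover_continuous.
Qed.

Definition dcomp (f : dfun R X) : dfun R Y :=
  DFun (@dcomp_continuous f) (cover_dense_preimage (@dfun_dense _ _ f)).

(* Finite sums of terms r * (f Z \o tau), for distinct Z in Zs. *)
Definition Stilde (Zs : set (set X)) (f : set X -> dfun R X) :
    set (dfun R Y) :=
  [set h | exists s : seq (R * set X),
     [/\ uniq [seq p.2 | p <- s], (forall p, p \in s -> Zs p.2) &
         dsum [seq dscale p.1 (dcomp (f p.2)) | p <- s] h]].

Definition A_of (Zs : set (set X)) (f : set X -> dfun R X) :
    set (dfun R Y) :=
  [set h | exists g s, [/\ Cfun R Y g, Stilde Zs f s & dadd g s h]].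

End Cover.

(* Main.v *)
Require Import Defs.
From mathcomp Require Import all_boot all_order all_algebra.
From mathcomp Require Import all_classical all_reals.
From mathcomp Require Import ereal topology normedtype borel_hierarchy.

Set Implicit Arguments.
Unset Strict Implicit.
Unset Printing Implicit Defensive.

Import Order.TTheory GRing.Theory Num.Theory.
Import numFieldNormedType.Exports.
Local Open Scope classical_set_scope.
Local Open Scope ring_scope.

(* Every element of [A] is pointwise [g + sum_Z c_Z f_Z(tau y)], and since the
   poles are disjoint at most one term is infinite at each point; equalities in
   [D(Y)] need only be checked on the dense set avoiding the poles. As [A]
   contains [C(Y)] and [Y] is zero-dimensional, compactness shows that the
   maximal ideals avoiding 1 are the ideals of functions vanishing at a point.
   For a nontrivial clopen [U], connectedness of [X] gives a fibre [tau^-1(p)]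
   meeting both [U] and its complement, so [f_p chi(U)], with a pole on only
   part of a fibre, is not in [A]. The component of 1 in a projection band is
   the indicator of a set in [lambda A], so projection bands are trivial,
   whereas the elements supported in a nontrivial clopen set form a proper
   nonzero band. *)

(** * Equalities and partial sums in [D(X)] tested on dense sets *)

Section DenseAgreement.
Context {R : realType} {X : topologicalType}.
Implicit Types (f g h : dfun R X) (D : set X).
Local Open Scope ereal_scope.

(** Continuity is asked at [x] alone, since a pointwise sum in [\bar R] is continuous only where it
    avoids [+oo - oo]. Disjoint open sets around distinct values would pull back to a neighbourhood
    of [x] whose interior meets [D]. *)
Lemma continuous_eq_dense_at (F G : X -> \bar R) D (x : X) :
  dense D -> (forall y, D y -> F y = G y) ->
  {for x, continuous F} -> {for x, continuous G} -> F x = G x.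
Proof.
move=> dD FG Fc Gc; apply: contrapT => /eqP FGx.
have := @ereal_hausdorff R; rewrite open_hausdorff => /(_ _ _ FGx).
move=> [[A B] /= [/set_mem AF /set_mem BG] [oA oB /eqP AB]].
have xAB : nbhs x (F @^-1` A `&` G @^-1` B).
  by apply: filterI; [apply: Fc | apply: Gc]; exact: open_nbhs_nbhs.
have [y [/(@interior_subset X)[Ay By] Dy]] :=
  dD _ (ex_intro _ x xAB) (@open_interior X _).
have : (A `&` B) (F y) by split => //; rewrite FG.
by rewrite AB.
Qed.

(** [dadd] speaks only of points where both terms are finite; density and continuity of addition
    extend it to every point where the sum is defined, poles included. *)
Lemma daddE f g h x : dadd f g h -> f x +? g x -> h x = f x + g x.
Proof.
move=> fgh fgx; apply: (@continuous_eq_dense_at h (fun y => f y + g y)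
  _ _ (dense_dfun_fin2 f g)).
- by move=> y [fy gy]; exact: fgh.
- exact: dfun_continuous.
- by apply: cvgeD => //; exact: dfun_continuous.
Qed.

Lemma dadd_dense f g h D : dense D -> (forall x, D x -> h x = f x + g x) ->
  dadd f g h.
Proof.
move=> dD fgh x fx gx.
apply: (@continuous_eq_dense_at h (fun y => f y + g y) _ _ dD fgh).
  exact: dfun_continuous.
apply: cvgeD; [|exact: dfun_continuous|exact: dfun_continuous].
exact: fin_num_adde_defr.
Qed.

Lemma Cfun_continuous (g : X -> R) : continuous g ->
  exists2 h, Cfun R X h & forall x, h x = (g x)%:E.
Proof.
move=> gc; have ec : continuous (fun x => (g x)%:E).
  by move=> x; apply: cvg_EFin; [exact: nearW|exact: gc].
have ed : dense [set x | (g x)%:E \is a fin_num].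
  by move=> O [x Ox] _; exists x.
by exists (DFun ec ed) => //; exists g.
Qed.

End DenseAgreement.

(** The balls of [\bar R] are by definition pulled back from [R] along [contract]. *)
Lemma contract_continuous {R : realType} :
  continuous (@contract R : \bar R -> R).
Proof.
move=> x; apply/cvg_ballP => e e0.
have := nbhsx_ballx x e e0; apply: filterS => y.
by rewrite /ball /= /ereal_ball /ball_.
Qed.

(** * Normal form [g + sum c_Z f_Z] of the elements of [A], and its closure properties *)

Section Span.
Context {R : realType} {X Y : topologicalType} {f : set X -> dfun R X}.
Context {tau : Y -> X}.
Hypothesis f_ge1 : forall Z, singletons Z -> forall x, (1 <= f Z x)%E.
Hypothesis f_pinfty : forall Z, singletons Z -> f Z @^-1` [set +oo%E] = Z.
Hypothesis Htau : is_cover tau.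
Implicit Types (g : Y -> R) (c : set X -> R) (s : seq (set X)).
Local Open Scope ereal_scope.

Definition all_singletons s := forall Z, Z \in s -> singletons Z.

(** Away from the poles all terms are finite, so identities there reduce to identities in [R]. *)
Definition off s : set Y := [set y | forall Z, Z \in s -> ~ Z (tau y)].

(** A zero coefficient cancels a pole, since [0 * +oo = 0] in [\bar R]. *)
Definition lincomb c s (y : Y) : \bar R := \sum_(Z <- s) (c Z)%:E * f Z (tau y).

Lemma singletons_inj (Z W : set X) x :
  singletons Z -> singletons W -> Z x -> W x -> Z = W.
Proof. by move=> [p _ <-] [q _ <-] /= -> ->. Qed.

Lemma f_fin_num Z x : singletons Z -> ~ Z x -> f Z x \is a fin_num.
Proof.
move=> sZ Zx; rewrite ge0_fin_numE; last
  by apply: le_trans (f_ge1 sZ x); exact: lee01.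
rewrite ltey; apply/eqP => fZx; apply: Zx.
by rewrite -(f_pinfty sZ).
Qed.

Lemma f_pole Z x : singletons Z -> Z x -> f Z x = +oo.
Proof. by move=> sZ Zx; rewrite -[Z](f_pinfty sZ) in Zx. Qed.

Lemma lincomb_fin_num c s y : all_singletons s ->
  (forall Z, Z \in s -> Z (tau y) -> c Z = 0%R) -> lincomb c s y \is a fin_num.
Proof.
move=> sS cs; rewrite /lincomb big_seq.
rewrite big_mkcond; apply: (big_ind (fun x => x \is a fin_num)) => //.
  by move=> u v uf vf; rewrite fin_numD uf vf.
move=> Z _; case: ifPn => // Zs; have [Zy|Zy] := pselect (Z (tau y)).
  by rewrite (cs _ Zs Zy) mul0e.
by rewrite fin_numM// f_fin_num//; exact: sS.
Qed.

Lemma lincomb_fine c s y : all_singletons s -> off s y ->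
  lincomb c s y = (\sum_(Z <- s) c Z * fine (f Z (tau y)))%:E.
Proof.
move=> sS sy; rewrite /lincomb -sumEFin; apply: eq_big_seq => Z Zs.
by rewrite EFinM fineK// f_fin_num//; [exact: sS | exact: sy].
Qed.

(** Distinct singletons are disjoint: if [tau y] lies in [Z], every later term is finite at [y];
    otherwise the first term is. *)
Lemma lincomb_cons_def c Z s y : uniq (Z :: s) -> all_singletons (Z :: s) ->
  (c Z)%:E * f Z (tau y) +? lincomb c s y.
Proof.
move=> /= /andP[Zs us] sS; have sZ : singletons Z.
  by apply: sS; rewrite inE eqxx.
have sS' : all_singletons s by move=> W Ws; apply: sS; rewrite inE Ws orbT.
have [Zy|Zy] := pselect (Z (tau y)); last first.
  by apply: fin_num_adde_defr; rewrite fin_numM// f_fin_num.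
apply: fin_num_adde_defl; apply: lincomb_fin_num => // W Ws Wy.
by move: Zs; rewrite (singletons_inj sZ (sS' _ Ws) Zy Wy) Ws.
Qed.

(** Each [f Z \o tau] is finite on an open dense set, and an open dense set meets a dense set in a
    dense set. *)
Lemma off_dense s : all_singletons s -> dense (off s).
Proof.
elim: s => [|Z s IH] sS; first by move=> O [y Oy] _; exists y.
have sZ : singletons Z by apply: sS; rewrite inE eqxx.
have /IH ds : all_singletons s.
  by move=> W Ws; apply: sS; rewrite inE Ws orbT.
move=> O O0 oO; pose F := dcomp Htau (f Z).
have [y [Oy [/= Fy sy]]] :=
  denseI (open_dfun_fin F) (@dfun_dense _ _ F) ds O0 oO.
exists y; split => // W; rewrite inE => /orP[/eqP->|]; last exact: sy.
by move=> Zy; move: Fy; rewrite f_pole.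
Qed.

Lemma dsum_lincomb c s k : uniq s -> all_singletons s ->
  dsum [seq dscale (c Z) (dcomp Htau (f Z)) | Z <- s] k ->
  forall y, k y = lincomb c s y.
Proof.
elim: s k => [|Z s IH] k us sS /=.
  by move=> -> y; rewrite /lincomb big_nil.
move=> [g sg gk] y; have gE y' : g y' = lincomb c s y'.
  apply: IH => //; first by case/andP: us.
  by move=> W Ws; apply: sS; rewrite inE Ws orbT.
have dZ := lincomb_cons_def c y us sS.
by rewrite (daddE gk) /= gE// /lincomb big_cons.
Qed.

Lemma lincomb_dsum c s : uniq s -> all_singletons s ->
  exists k, dsum [seq dscale (c Z) (dcomp Htau (f Z)) | Z <- s] k.
Proof.
elim: s => [|Z s IH] us sS; first by exists (dcst 0).
have us' : uniq s by case/andP: us.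
have sS' : all_singletons s by move=> W Ws; apply: sS; rewrite inE Ws orbT.
have [k sk] := IH us' sS'; pose F := dscale (c Z) (dcomp Htau (f Z)).
have kE := dsum_lincomb us' sS' sk.
have ec : continuous (fun y => F y + k y).
  move=> y; apply: cvgeD; [|exact: dfun_continuous|exact: dfun_continuous].
  by rewrite kE; exact: lincomb_cons_def.
have ed : dense [set y | F y + k y \is a fin_num].
  move=> O O0 oO; have [y [Oy [Fy ky]]] := dense_dfun_fin2 F k O0 oO.
  by exists y; split => //=; rewrite fin_numD Fy ky.
by exists (DFun ec ed), k.
Qed.

Lemma Stilde_lincomb k : Stilde Htau (@singletons X) f k ->
  exists c s, [/\ uniq s, all_singletons s & forall y, k y = lincomb c s y].
Proof.
move=> [sp [usp sS spk]].
(* As the sets in [sp] are distinct, its scalars form a function of the set. *)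
have [c cE] : exists c, forall p, p \in sp -> c p.2 = p.1.
  elim: sp usp {sS spk} => [|p sp IH] /=; first by exists (fun=> 0%R).
  move=> /andP[psp /IH[c cE]].
  exists (fun Z => if Z == p.2 then p.1 else c Z) => q.
  rewrite inE => /orP[/eqP->|qsp]; first by rewrite eqxx.
  case: ifPn => [/eqP qp|_]; last exact: cE.
  by move: psp; rewrite -qp map_f.
have sS' : all_singletons [seq p.2 | p <- sp].
  by move=> Z /mapP[p psp ->]; exact: sS.
exists c, [seq p.2 | p <- sp]; split => //; apply: dsum_lincomb => //.
rewrite -map_comp (_ : map _ _ =
    [seq dscale p.1 (dcomp Htau (f p.2)) | p <- sp])//.
by apply/eq_in_map => p psp /=; rewrite cE.
Qed.

Notation A := (A_of Htau (@singletons X) f).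

Definition represents g c s (h : dfun R Y) :=
  forall y, h y = (g y)%:E + lincomb c s y.

Lemma A_of_represented h : A h -> exists g c s,
  [/\ continuous g, uniq s, all_singletons s & represents g c s h].
Proof.
move=> [G [k [[g gc gE] /Stilde_lincomb[c [s [us sS kE]]] gk]]].
exists g, c, s; split => // y; by rewrite -kE (daddE gk) ?gE.
Qed.

Lemma represented_A_of g c s : continuous g -> uniq s -> all_singletons s ->
  exists h, A h /\ represents g c s h.
Proof.
move=> gc us sS; have [k sk] := lincomb_dsum c us sS.
have kE := dsum_lincomb us sS sk.
have [G CG GE] := Cfun_continuous gc.
have Gk y : G y +? k y by apply: fin_num_adde_defr; rewrite GE.
have ec : continuous (fun y => G y + k y).
  by move=> y; apply: cvgeD => //; exact: dfun_continuous.
have ed : dense [set y | G y + k y \is a fin_num].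
  move=> O O0 oO; have [y [Oy [Fy ky]]] := dense_dfun_fin2 G k O0 oO.
  by exists y; split => //=; rewrite fin_numD Fy ky.
exists (DFun ec ed); split => [|y /=]; last by rewrite GE kE.
exists G, k; split => //; exists [seq (c Z, Z) | Z <- s]; split.
- by rewrite -map_comp map_id.
- by move=> p /mapP[Z Zs ->]; exact: sS.
- by rewrite -map_comp.
Qed.

Lemma represents_fine g c s h y : all_singletons s -> represents g c s h ->
  off s y -> h y = (g y + \sum_(Z <- s) c Z * fine (f Z (tau y)))%:E.
Proof. by move=> sS hE sy; rewrite hE lincomb_fine. Qed.

Lemma represents_fin_num g c s h y : all_singletons s -> represents g c s h ->
  (forall Z, Z \in s -> Z (tau y) -> c Z = 0%R) -> h y \is a fin_num.
Proof. by move=> sS -> cy; rewrite fin_numD lincomb_fin_num. Qed.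

(* At a pole with nonzero coefficient only one term is infinite. *)
Lemma represents_pole g c s h y Z : uniq s -> all_singletons s ->
  represents g c s h -> Z \in s -> Z (tau y) -> c Z <> 0%R ->
  h y \isn't a fin_num.
Proof.
move=> us sS -> Zs Zy cZ; rewrite fin_numD /= /lincomb (bigD1_seq Z)//=.
rewrite fin_numD f_pole//; last exact: sS.
by have [c0|c0|] := ltgtP (c Z) 0%R => //;
  [rewrite lt0_muley | rewrite gt0_muley].
Qed.

(** Padding with zero coefficients lets two elements of [A] share one list of poles. *)
Lemma lincomb_widen c s t y : uniq s -> uniq t -> {subset s <= t} ->
  lincomb (fun Z => if Z \in s then c Z else 0%R) t y = lincomb c s y.
Proof.
move=> us ut st; rewrite /lincomb.
rewrite (eq_bigr (fun Z => if Z \in s then (c Z)%:E * f Z (tau y) else 0)).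
  rewrite -big_mkcond -big_filter; apply: perm_big; apply: uniq_perm => //.
    exact: filter_uniq.
  by move=> Z; rewrite mem_filter andb_idr//; exact: st.
by move=> Z _; case: ifP => // _; rewrite mul0e.
Qed.

Lemma A_of_represented2 h k : A h -> A k -> exists g g' c c' s,
  [/\ continuous g /\ continuous g', uniq s, all_singletons s,
      represents g c s h & represents g' c' s k].
Proof.
move=> /A_of_represented[g [c [s [gc us sS hE]]]].
move=> /A_of_represented[g' [c' [s' [g'c us' sS' kE]]]].
have ut := undup_uniq (s ++ s').
exists g, g', (fun Z => if Z \in s then c Z else 0%R),
  (fun Z => if Z \in s' then c' Z else 0%R), (undup (s ++ s')); split => //.
- by move=> Z; rewrite mem_undup mem_cat => /orP[/sS|/sS'].
- move=> y; rewrite lincomb_widen// => Z Zs.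
  by rewrite mem_undup mem_cat Zs.
- move=> y; rewrite lincomb_widen// => Z Zs.
  by rewrite mem_undup mem_cat Zs orbT.
Qed.

Lemma Cfun_A_of h : Cfun R Y h -> A h.
Proof.
move=> [g gc hE].
have [k [Ak kE]] : exists k, A k /\ represents g (fun=> 0%R) [::] k.
  exact: represented_A_of.
rewrite (_ : h = k)//; apply: dfunP => y.
by rewrite kE /lincomb big_nil adde0.
Qed.

Lemma A_ofD h k : A h -> A k -> exists l, A l /\ dadd h k l.
Proof.
move=> Ah Ak; have [g [g' [c [c' [s [[gc g'c] us sS hE kE]]]]]] :=
  A_of_represented2 Ah Ak.
have [l [Al lE]] : exists l, A l /\
    represents (fun y => g y + g' y)%R (fun Z => c Z + c' Z)%R s l.
  by apply: represented_A_of => // y; apply: cvgD; [exact: gc|exact: g'c].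
exists l; split => //; apply: (dadd_dense (off_dense sS)) => y sy.
rewrite (represents_fine sS hE)// (represents_fine sS kE)//.
rewrite (represents_fine sS lE)// -EFinD; congr EFin.
under eq_bigr do rewrite mulrDl.
by rewrite big_split /= addrACA.
Qed.

Lemma A_ofZ r h : A h -> A (dscale r h).
Proof.
move=> /A_of_represented[g [c [s [gc us sS hE]]]].
have [l [Al lE]] : exists l, A l /\
    represents (fun y => r * g y)%R (fun Z => r * c Z)%R s l.
  by apply: represented_A_of => // y; apply: cvgMr; exact: gc.
rewrite (_ : dscale r h = l)//.
apply: (dfun_eq_dense (off_dense sS)) => y sy /=.
rewrite (represents_fine sS hE)// (represents_fine sS lE)// -EFinM.
congr EFin; rewrite mulrDr mulr_sumr; congr (_ + _)%R.
by apply: eq_bigr => Z _; rewrite mulrA.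
Qed.

(* With [m = max(c, c')], the join of [g + sum c f] and [g' + sum c' f] is
   [sum m f - min(u, v)], where [u] and [v] have the coefficients [m - c] and
   [m - c'], which are nonnegative and never both nonzero: [min(u, v)] is
   everywhere finite. *)
Lemma A_of_join h k : A h -> A k -> A (Order.join h k).
Proof.
move=> Ah Ak; have [g [g' [c [c' [s [[gc g'c] us sS hE kE]]]]]] :=
  A_of_represented2 Ah Ak.
pose m Z := Num.max (c Z) (c' Z).
have [u [Au uE]] : exists u, A u /\
    represents (fun y => - g y)%R (fun Z => m Z - c Z)%R s u.
  by apply: represented_A_of => // y; apply: cvgN; exact: gc.
have [v [Av vE]] : exists v, A v /\
    represents (fun y => - g' y)%R (fun Z => m Z - c' Z)%R s v.
  by apply: represented_A_of => // y; apply: cvgN; exact: g'c.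
have ge0 d w n y : represents n d s w -> (forall Z, 0 <= d Z)%R ->
    -oo < w y.
  move=> wE d0; rewrite wE (@lt_le_trans _ _ (n y)%:E)// ?ltNyr//.
  rewrite leeDl// /lincomb big_seq; apply: sume_ge0 => Z Zs.
  rewrite mule_ge0// ?lee_fin//.
  by apply: le_trans (f_ge1 (sS _ Zs) _); exact: lee01.
have uNy y : -oo < u y.
  by apply: (ge0 _ _ _ _ uE) => Z; rewrite subr_ge0 le_max lexx.
have vNy y : -oo < v y.
  by apply: (ge0 _ _ _ _ vE) => Z; rewrite subr_ge0 le_max lexx orbT.
have min_fin y : dmin u v y \is a fin_num.
  rewrite /= fin_numElt lt_min uNy vNy /= gt_min.
  (* Over a pole [Z], the larger of [c Z] and [c' Z] equals [m Z], so the matching one of [u] and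
     [v] has coefficient zero and is finite at [y]. *)
  have [[Z [Zs Zy]]|nZ] := pselect (exists Z, Z \in s /\ Z (tau y)).
    have same W : W \in s -> W (tau y) -> W = Z.
      by move=> Ws Wy; apply: (singletons_inj (sS _ Ws) (sS _ Zs) Wy).
    have [cc|cc] := leP (c Z) (c' Z).
      apply/orP; right; rewrite ltey_eq.
      rewrite (represents_fin_num sS vE)// => W Ws /(same _ Ws)->.
      by rewrite /m max_r ?subrr.
    apply/orP; left; rewrite ltey_eq.
    rewrite (represents_fin_num sS uE)// => W Ws /(same _ Ws)->.
    by rewrite /m max_l ?subrr// ltW.
  rewrite ltey_eq (represents_fin_num sS uE)// => W Ws Wy.
  by case: nZ; exists W.
have wc : continuous (fun y => - fine (dmin u v y))%R.
  move=> y; apply: cvgN; apply: fine_cvg; rewrite fineK//.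
  exact: dfun_continuous.
have [l [Al lE]] : exists l, A l /\
    represents (fun y => - fine (dmin u v y))%R m s l.
  exact: represented_A_of.
rewrite (_ : Order.join h k = l)//.
apply: (dfun_eq_dense (off_dense sS)) => y sy.
rewrite (represents_fine sS lE)// [LHS]/=.
rewrite (represents_fine sS hE)// (represents_fine sS kE)//.
rewrite [dmin _ _ _]/= (represents_fine sS uE)// (represents_fine sS vE)//.
have sumB d : (\sum_(Z <- s) (m Z - d Z) * fine (f Z (tau y)) =
    \sum_(Z <- s) m Z * fine (f Z (tau y)) -
    \sum_(Z <- s) d Z * fine (f Z (tau y)))%R.
  by rewrite -sumrB; apply: eq_bigr => Z _; rewrite mulrBl.
rewrite !sumB; set S := (\sum_(Z <- s) _)%R; set S' := (\sum_(Z <- s) _)%R.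
set M := (\sum_(Z <- s) _)%R.
rewrite -EFin_max -EFin_min /=; congr EFin.
(* What remains is [max(a, b) = M - min(M - a, M - b)] in [R]. *)
have e x z : (- x + (M - z) = M - (x + z))%R by rewrite opprD addrCA.
rewrite !e; have [ab|ba] := leP (g y + S)%R (g' y + S')%R.
  by rewrite min_r ?lerD2l ?lerN2// opprB subrK.
by rewrite min_l ?lerD2l ?lerN2 ?(ltW ba)// opprB subrK.
Qed.

Lemma A_of_meet h k : A h -> A k -> A (Order.meet h k).
Proof.
move=> Ah Ak.
rewrite (_ : Order.meet h k =
    dscale (-1) (Order.join (dscale (-1) h) (dscale (-1) k))).
  by apply: A_ofZ; apply: A_of_join; exact: A_ofZ.
apply: dfunP => y /=; rewrite !mulN1e oppe_max !oppeK//.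
Qed.

Lemma A_of_vlattice_in : vlattice_in A.
Proof.
split; [|exact: A_ofD|exact: A_ofZ|exact: A_of_meet|exact: A_of_join].
by apply: Cfun_A_of; exists (fun=> 1%R) => // y; exact: cvg_cst.
Qed.

End Span.

(** * Pointwise operations, the archimedean property, and maximal ideals as points *)

Section PointwiseLattice.
Context {R : realType} {Y : topologicalType} {A : set (dfun R Y)}.
Variable HA : vlattice_in A.
Notation V := (vl_of HA).
Implicit Types (a b : V) (y : Y).
Local Open Scope ereal_scope.

Lemma vl_ext a b : (forall y, a y = b y) -> a = b.
Proof. by move=> ab; apply/vl_inj/dfunP. Qed.

Lemma vl_leP a b : reflect (forall y, a y <= b y) (a <= b)%R.
Proof. exact: asboolP. Qed.

Lemma vl_addE_def a b y : a y +? b y -> (a + b)%R y = a y + b y.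
Proof. by apply: (@daddE _ _ a b (vl_add a b)); exact: vl_addP. Qed.

Lemma vl_oppE a y : (- a)%R y = - a y.
Proof. exact: mulN1e. Qed.

Lemma labsE a y : labs a y = `|a y|.
Proof.
have -> : labs a y = maxe (a y) ((- a)%R y) by [].
by rewrite vl_oppE; case: (a y) => //= r; rewrite -EFin_max maxrN.
Qed.

Lemma vl_mulrnE a y n : a y \is a fin_num ->
  (a *+ n)%R y = (fine (a y) *+ n)%:E.
Proof.
move=> ay; elim: n => [|n IH]; first by rewrite mulr0n.
rewrite !mulrS vl_addE_def IH; first by rewrite EFinD fineK.
exact: fin_num_adde_defl.
Qed.

(** On the dense set where [a] and [b] are both finite this is the archimedean property of [R]. *)
Lemma vl_of_archimedean : archimedean_vl V.
Proof.
move=> a b a0 ab; apply/vl_inj/(dfun_eq_dense (dense_dfun_fin2 a b)).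
move=> y [ay by_]; have /vl_leP/(_ y) ay0 := a0.
have {}ab n : ((fine (a y)) *+ n <= fine (b y))%R.
  have /vl_leP/(_ y) := ab n.
  by rewrite vl_mulrnE// -[b y]fineK.
rewrite -[a y]fineK//; congr EFin; apply/le_anti/andP; split; last first.
  by rewrite fine_ge0.
rewrite leNgt; apply/negP => r0.
have b0 : (0 <= fine (b y) / fine (a y))%R.
  by apply: divr_ge0; [have := ab 0%N; rewrite mulr0n | exact: fine_ge0].
have := archi_boundP b0; rewrite ltr_pdivrMr// mulr_natl => /lt_geF.
by rewrite ab.
Qed.

Lemma ideal_unit (I : set V) a : is_ideal I -> I a ->
  (forall y, 1 <= a y) -> I (vl_one HA).
Proof.
move=> II Ia a1; apply: (ideal_le II Ia); apply/vl_leP => y.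
by rewrite labsE /= normr1.
Qed.

Lemma vl_of_weak_order_unit (y0 : Y) : weak_order_unit (vl_one HA).
Proof.
split.
  rewrite lt_neqAle; apply/andP; split; last first.
    by apply/vl_leP => y /=; rewrite lee01.
  apply/eqP => /(congr1 (fun a : V => a y0)) /= /eqP.
  by rewrite eq_sym onee_eq0.
move=> a a1; apply: vl_ext => y; apply/eqP; rewrite -abse_eq0 -labsE.
have : vmeet (labs a) (vl_one HA) y = (0%R : V) y by rewrite a1.
rewrite [LHS]/= [RHS]/=; have [l1 -> //|l1 /eqP] := leP (labs a y) 1.
by rewrite onee_eq0.
Qed.

Definition point_ideal y : set V := [set a | a y = 0].

Lemma point_ideal_is_ideal y : is_ideal (point_ideal y).
Proof.
split.
- by [].
- move=> a b ay by_; rewrite /point_ideal /mkset.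
  by rewrite vl_addE_def ay by_ ?adde0.
- by move=> r a ay; rewrite /point_ideal /mkset [LHS]/= ay mule0.
- move=> a b /= ay /vl_leP/(_ y); rewrite !labsE ay abse0 => b0.
  by apply/eqP; rewrite -abse_eq0 eq_le b0 abse_ge0.
Qed.

Lemma point_ideal_unit y : ~ point_ideal y (vl_one HA).
Proof. by move=> /= /eqP; rewrite onee_eq0. Qed.

Lemma scale_gt1 (x : \bar R) : 0 < x ->
  exists2 r : R, (0 <= r)%R & 1 < r%:E * x.
Proof.
case: x => [x| |] //.
  rewrite lte_fin => x0; exists (2 / x)%R; first by rewrite divr_ge0// ltW.
  by rewrite -EFinM divfK ?gt_eqF// lte_fin ltr1n.
by move=> _; exists 1%R => //; rewrite mul1e ltry.
Qed.

Lemma labs_scale_gt1 a y : a y <> 0 ->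
  exists2 r : R, (0 <= r)%R & 1 < (r *: labs a)%R y.
Proof.
move=> ay; have [|r r0 r1] := @scale_gt1 (labs a y).
  by rewrite labsE lt_neqAle abse_ge0 andbT eq_sym abse_eq0; apply/eqP.
by exists r.
Qed.

Lemma point_ideal_maximal y : maximal_avoiding (vl_one HA) (point_ideal y).
Proof.
split; [exact: point_ideal_is_ideal|exact: point_ideal_unit|].
move=> J IJ Ju pJ; apply/seteqP; split => // a Ja; apply: contrapT => ay.
have [r r0 ray] := labs_scale_gt1 ay; pose c : V := (r *: labs a)%R.
have Jc : J c by apply: (idealZ IJ); exact: ideal_labs.
have c0 x : 0 <= c x by rewrite mule_ge0// labsE.
(* Since [c y > 1], the function [b = max(1 - c, 0)] vanishes at [y] and so lies in [J]; but
   [b + c >= 1] everywhere, which forces the unit into [J]. *)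
pose b : V := vjoin (vl_one HA - c)%R 0%R.
have bE x : b x = maxe (1 - c x) 0.
  have -> : b x = maxe ((vl_one HA - c)%R x) 0 by [].
  by rewrite vl_addE_def vl_oppE//; exact: fin_num_adde_defr.
have Jb : J b.
  apply: pJ; rewrite /point_ideal /mkset bE max_r//.
  by rewrite sube_le0 ltW.
apply: Ju; apply: (ideal_unit IJ (idealD IJ Jb Jc)) => x.
have b0 : 0 <= b x by rewrite bE le_max lexx orbT.
rewrite vl_addE_def; last by apply: ge0_adde_def; rewrite inE.
rewrite bE; move: (c0 x); case: (c x) => [t| |] // t0.
  rewrite -EFinB -EFin_max -EFinD lee_fin.
  by rewrite -lerBlDr le_max lexx.
(* The remaining case is [c x = +oo], where [b x >= 0] makes the sum [+oo]. *)
by rewrite addey ?leey// gt_eqF// (@lt_le_trans _ _ 0)// le_max lexx orbT.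
Qed.

(** If [M] is no point ideal, maximality keeps it out of every point ideal, so each [y] has an
    element of [M] exceeding 1 near [y]. Compactness merges these into one element of [M] that is at
    least 1 everywhere. *)
Lemma maximal_avoiding_point (M : set V) : compact [set: Y] ->
  maximal_avoiding (vl_one HA) M -> exists y, M = point_ideal y.
Proof.
move=> cY [IM Mu Mmax]; apply: contrapT => /forallNP nM.
have nM' y : exists2 c, M c & 1 < c y.
  have : ~ M `<=` point_ideal y.
    move=> Mp; apply: (nM y).
    rewrite (Mmax _ (point_ideal_is_ideal y) _ Mp)//.
    exact: point_ideal_unit.
  move=> /existsNP[a /not_implyP[Ma /labs_scale_gt1[r r0 ray]]].
  exists (r *: labs a)%R => //; apply: (idealZ IM); exact: ideal_labs.
(* The upper sets within [M] are directed by [labs a + labs b]; the near-covering form of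
   compactness replaces a finite subcover. *)
pose up (a : V) := [set b | M b /\ (a <= b)%R].
have FF : Filter (filter_from M up).
  apply: filter_from_filter; first by exists 0%R; exact: ideal0.
  move=> a b Ma Mb; exists (labs a + labs b)%R.
    by apply: (idealD IM); exact: ideal_labs.
  move=> c [Mc abc]; split; split => //; apply: le_trans abc.
    rewrite -[X in (X <= _)%R]addr0; apply: vl_leD; first exact: le_labs.
    exact: labs_ge0.
  rewrite -[X in (X <= _)%R]add0r; apply: vl_leD; first exact: labs_ge0.
  exact: le_labs.
have [|a Ma aP] := (compact_near_coveringP _).1 cY V _
    (fun b y => 1 <= b y) FF.
  move=> y _; have [c Mc cy] := nM' y.
  exists ([set x | 1 < c x], up c) => /=.
    split; last by exists c.
    apply: open_nbhs_nbhs; split => //.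
    apply: (@open_comp _ _ c [set x | 1 < x]); last exact: open_ereal_gt_ereal.
    by move=> x _; exact: dfun_continuous.
  move=> [x b] [/= cx [Mb /vl_leP cb]].
  by apply: le_trans (cb x); exact: ltW.
apply: Mu; apply: (ideal_unit IM Ma) => y; exact: aP.
Qed.

End PointwiseLattice.

(** * Separation and indicators by clopen sets *)

Section ClopenBase.
Context {Y : topologicalType}.
Hypothesis ZDY : clopen_base Y.

Lemma clopen_nbhs y (O : set Y) : nbhs y O ->
  exists U, [/\ clopen U, U y & U `<=` O].
Proof. by move=> /ZDY.2[U [cU Uy] UO]; exists U. Qed.

Lemma clopen_separation (E F : set Y) : compact [set: Y] ->
  closed E -> closed F -> E `&` F = set0 ->
  exists U, [/\ clopen U, E `<=` U & U `&` F = set0].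
Proof.
move=> cY cE cF EF; pose D := [set U : set Y | clopen U /\ U `&` F = set0].
(* The clopen sets missing [F] are directed by union, so near-covering of the compact set [E] yields
   one of them containing [E]. *)
pose up (U : set Y) := [set W : set Y | D W /\ U `<=` W].
have FF : Filter (filter_from D up).
  apply: filter_from_filter.
    by exists set0; split; [exact: clopen0 | rewrite set0I].
  move=> U W [cU UF] [cW WF]; exists (U `|` W).
    by split; [exact: clopenU | rewrite setIUl UF WF setU0].
  move=> T [DT UWT]; split; split => //; apply: subset_trans UWT.
    exact: subsetUl.
  exact: subsetUr.
have kE : compact E by exact: (subclosed_compact cE cY).
have [|U DU UP] := (compact_near_coveringP _).1 kE (set Y) _
    (fun W y => W y) FF; last first.
  by have [cU UF] := DU; exists U; split => //; apply: (UP U); split.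
move=> y Ey; have [U [cU Uy UF]] : exists U, [/\ clopen U, U y & U `<=` ~` F].
  apply: clopen_nbhs; apply: open_nbhs_nbhs; split; first exact: closed_openC.
  move=> Fy; have : (E `&` F) y by split.
  by rewrite EF.
exists (U, up U) => /=.
  split; first by apply: open_nbhs_nbhs; split => //; case: cU.
  exists U => //; split => //; apply/seteqP; split => // z [Uz Fz].
  exact: (UF z Uz).
by move=> [z W] [/= Uz [_ UW]]; exact: UW.
Qed.

Lemma clopen_indicator_continuous (R : realType) (U : set Y) (r : R) :
  clopen U -> continuous (fun y => if y \in U then r else 0).
Proof.
move=> [oU cU] y; apply: cvg_near_cst; have [Uy|Uy] := pselect (U y).
  rewrite mem_set//; near=> z; rewrite mem_set//; near: z.
  exact: open_nbhs_nbhs.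
rewrite memNset//; near=> z; rewrite memNset//; near: z.
by apply: open_nbhs_nbhs; split => //; exact: closed_openC.
Unshelve. all: by end_near. Qed.

End ClopenBase.

(** * The homeomorphism of [Y] with the Yosida space *)

Section YosidaSpace.
Context {R : realType} {Y : topologicalType} {A : set (dfun R Y)}.
Variable HA : vlattice_in A.
Hypothesis CA : Cfun R Y `<=` A.
Hypothesis cY : compact [set: Y].
Hypothesis hY : hausdorff_space Y.
Hypothesis ZDY : clopen_base Y.
Notation V := (vl_of HA).
Notation YA := (yosida (vl_one HA)).
Local Open Scope ereal_scope.

Lemma vl_indicator (U : set Y) (r : R) : clopen U ->
  exists a : V, forall y, a y = (if y \in U then r else 0%R)%:E.
Proof.
move=> cU; have [h Ch hE] := Cfun_continuous
  (@clopen_indicator_continuous _ R U r cU).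
by exists (VLOf HA (CA Ch)).
Qed.

Lemma yosida_ext (M N : YA) : (M : set V) = N -> M = N.
Proof.
case: M N => [M HM] [N HN] /= MN; subst N.
by congr Yosida; exact: Prop_irrelevance.
Qed.

Definition yosida_point (y : Y) : YA := Yosida (point_ideal_maximal HA y).

Lemma yosida_point_surj (M : YA) : exists y, yosida_point y = M.
Proof.
have [y My] := maximal_avoiding_point cY (yosidaP M).
by exists y; apply: yosida_ext.
Qed.

Definition yosida_coord (M : YA) : Y := proj1_sig (cid (yosida_point_surj M)).

Lemma yosida_coordK : cancel yosida_coord yosida_point.
Proof. by move=> M; rewrite /yosida_coord; case: cid. Qed.

Lemma clopen_separate_points (x y : Y) : x <> y ->
  exists U : set Y, [/\ clopen U, U x & ~ U y].
Proof.
move=> /eqP xy; move: hY; rewrite open_hausdorff => /(_ _ _ xy).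
move=> [[O W] /= [/set_mem Ox /set_mem Wy] [oO _ /eqP OW]].
have [U [cU Ux UO]] := clopen_nbhs ZDY (open_nbhs_nbhs (conj oO Ox)).
exists U; split => // /UO Oy; have : (O `&` W) y by split.
by rewrite OW.
Qed.

Lemma yosida_point_inj : injective yosida_point.
Proof.
move=> x y xy; apply: contrapT => nxy.
have [U [cU Ux Uy]] := clopen_separate_points nxy.
have [a aE] := vl_indicator 1 cU.
have : (yosida_point y : set V) a by rewrite /= /point_ideal /= aE memNset.
rewrite -xy /= /point_ideal /= aE mem_set// => /eqP.
by rewrite onee_eq0.
Qed.

Lemma yosida_pointK : cancel yosida_point yosida_coord.
Proof. by move=> y; apply: yosida_point_inj; rewrite yosida_coordK. Qed.

Lemma yosida_point_continuous : continuous yosida_point.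
Proof.
apply/continuousP => _ [S ->].
(* The complement of the hull of [S] pulls back to the union of the cozero sets of the members of
   [S]. *)
rewrite (_ : _ @^-1` _ = \bigcup_(a in S) (a @^-1` [set x | x <> 0])).
  apply: bigcup_open => a Sa; apply: open_comp.
    by move=> y _; exact: dfun_continuous.
  rewrite (_ : [set x | x <> 0] = [set x | x < 0] `|` [set x | 0 < x]).
    by apply: openU; [exact: open_ereal_lt_ereal|exact: open_ereal_gt_ereal].
  apply/seteqP; split => x /=.
    by move=> /eqP; rewrite neq_lt => /orP.
  by move=> [x0 e|x0 e]; rewrite e ltxx in x0.
apply/seteqP; split => y /=.
  by move=> /existsNP[a /not_implyP[Sa ay]]; exists a.
by move=> [a Sa ay] Sy; apply: ay; exact: (Sy a Sa).
Qed.

Lemma yosida_coord_continuous : continuous yosida_coord.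
Proof.
apply/continuousP => O oO.
(* The complement of [O] corresponds to the hull of the elements vanishing off [O]: for a point of
   [O], the indicator of a clopen neighbourhood inside [O] is such an element and is nonzero
   there. *)
exists [set a : V | forall y, ~ O y -> a y = 0].
apply/seteqP; split => M /=; last first.
  move=> /existsNP[a /not_implyP[aO Ma]]; apply: contrapT => MO; apply: Ma.
  by rewrite -(yosida_coordK M); exact: aO.
move=> OM SM;
have [U [cU UM UO]] := clopen_nbhs ZDY (open_nbhs_nbhs (conj oO OM)).
have [a aE] := vl_indicator 1 cU.
have : (M : set V) a.
  by apply: SM => y Oy; rewrite aE memNset// => /UO.
rewrite -(yosida_coordK M) /= /point_ideal /= aE mem_set// => /eqP.
by rewrite onee_eq0.
Qed.

Lemma yosida_eta_dense (a : V) :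
  dense [set M : YA | (a \o yosida_coord) M \is a fin_num].
Proof.
move=> O [M OM] oO.
have [|y [Oy ay]] := @dfun_dense _ _ a (yosida_point @^-1` O) _
  (@open_comp _ _ yosida_point O (fun y _ => @yosida_point_continuous y) oO).
  by exists (yosida_coord M); rewrite /= yosida_coordK.
by exists (yosida_point y); split => //=; rewrite yosida_pointK.
Qed.

Lemma yosida_eta_continuous (a : V) : continuous (a \o yosida_coord).
Proof.
move=> M; apply: continuous_comp; first exact: yosida_coord_continuous.
exact: dfun_continuous.
Qed.

Definition yosida_eta (a : V) : dfun R YA :=
  DFun (@yosida_eta_continuous a) (@yosida_eta_dense a).

Lemma vlattice_yosida_space_is : yosida_space_is HA.
Proof.
exists yosida_point; split.
  split; first exact: yosida_point_continuous.
  exists yosida_coord; split; [exact: yosida_coord_continuous| |].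
    exact: yosida_pointK.
  exact: yosida_coordK.
exists yosida_eta; split; last by move=> a y; rewrite /= yosida_pointK.
split.
- move=> a b ab; apply: vl_ext => y.
  have := congr1 (fun g : dfun R YA => g (yosida_point y)) ab.
  by rewrite /= yosida_pointK.
- by move=> a b M aM bM; exact: vlDE.
- by move=> r a; exact: dfunP.
- by move=> a b; exact: dfunP.
- by move=> a b; exact: dfunP.
- exact: dfunP.
- move=> E F cE cF EF.
  have ch D : closed D -> closed (yosida_point @^-1` D).
    by move=> cD; apply: closed_comp => // y _; exact: yosida_point_continuous.
  have [|U [cU EU UF]] := clopen_separation ZDY cY (ch _ cE) (ch _ cF).
    by rewrite -preimage_setI EF preimage_set0.
  (* As [U] contains [E] and misses [F], the indicator of its complement is 0 on [E] and 1 on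
     [F]. *)
  have [a aE] := vl_indicator 1 (clopenC U cU).
  exists a; split => M MEF; rewrite /= aE.
    by rewrite memNset// => /=; apply; apply: EU; rewrite /= yosida_coordK.
  rewrite mem_set// => /= UM.
  have : (U `&` yosida_point @^-1` F) (yosida_coord M).
    by split => //=; rewrite yosida_coordK.
  by rewrite UF.
Qed.

Lemma yosida_clopen_base : clopen_base YA.
Proof.
split; first by move=> U [].
move=> M O /=; rewrite -{1}(yosida_coordK M) => MO.
have [U [cU UM UO]] := clopen_nbhs ZDY (yosida_point_continuous MO).
exists (yosida_coord @^-1` U).
  split => //; apply: preimage_clopen => //; exact: yosida_coord_continuous.
by move=> N /= /UO; rewrite /= yosida_coordK.
Qed.

End YosidaSpace.

(** * Bands and direct sums in an arbitrary vector lattice *)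

Section Bands.
Context {R : realType} {V : vectorLatticeType R}.
Implicit Types (a b x : V) (B : set V).

Lemma labs_le0 a : labs a <= 0 -> a = 0.
Proof.
rewrite labs_le => /andP[a0 /(vl_leD2r a)].
by rewrite addNr add0r => a0'; apply/le_anti; rewrite a0 a0'.
Qed.

Lemma is_ideal_set0 : is_ideal [set 0 : V].
Proof.
split => //.
- by move=> a b -> ->; rewrite /= addr0.
- by move=> r a ->; rewrite /= scaler0.
- by move=> a b -> b0; apply: labs_le0; rewrite (ger0_labs (lexx 0)) in b0.
Qed.

Lemma is_band_set0 : is_band [set 0 : V].
Proof.
split; first exact: is_ideal_set0.
move=> S x S0 [xub xlub]; apply/le_anti/andP; split.
  by apply: xlub => s /S0 ->.
(* [S] may be empty, so [x] cannot be compared with a member of [S]. In either case [x + x] is an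
   upper bound of [S], whence [0 <= x]. *)
have : x <= x + x.
  apply: xlub => s Ss; have := xub s Ss; rewrite (S0 _ Ss) => x0.
  by rewrite -[0]addr0; exact: vl_leD.
by rewrite vl_lesub subrr.
Qed.

Lemma is_band_setT : is_band [set: V].
Proof. by []. Qed.

Lemma direct_sum_sym B B' : direct_sum B B' -> direct_sum B' B.
Proof.
move=> [sBB' BB']; split; last by rewrite setIC.
by move=> a; have [b [b' [Bb Bb' ->]]] := sBB' a; exists b', b; rewrite addrC.
Qed.

Lemma direct_sum0T : direct_sum [set 0 : V] [set: V].
Proof.
split; last by rewrite setIT.
by move=> a; exists 0, a; rewrite add0r.
Qed.

(** By solidity the meet lies in both ideals, which intersect in 0. *)
Lemma direct_sum_disjoint B B' b b' : is_ideal B -> is_ideal B' ->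
  direct_sum B B' -> B b -> B' b' -> vmeet (labs b) (labs b') = 0.
Proof.
move=> IB IB' [_ BB'] Bb Bb'.
have m0 : 0 <= vmeet (labs b) (labs b') by rewrite vmeetP !labs_ge0.
have : (B `&` B') (vmeet (labs b) (labs b')) by split;
  [apply: (ideal_le IB (ideal_labs IB Bb)) |
   apply: (ideal_le IB' (ideal_labs IB' Bb'))];
  rewrite ger0_labs// ?vmeet_lel ?vmeet_ler.
by rewrite BB'.
Qed.

End Bands.

(** * Projection bands and clopen sets in a vector lattice inside [D(Y)] *)

Section ClopenBands.
Context {R : realType} {Y : topologicalType} {A : set (dfun R Y)}.
Variable HA : vlattice_in A.
Notation V := (vl_of HA).
Local Open Scope ereal_scope.

Lemma direct_sum_vanish (B B' : set V) b b' y : is_ideal B -> is_ideal B' ->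
  direct_sum B B' -> B b -> B' b' -> b y = 0 \/ b' y = 0.
Proof.
move=> IB IB' BB' Bb Bb'.
have /(congr1 (fun a : V => a y)) := direct_sum_disjoint IB IB' BB' Bb Bb'.
rewrite [LHS]/= -/(labs b y) [RHS]/=.
have -> : mine (labs b y) (labs b' y) = mine `|b y| `|b' y|.
  by rewrite !labsE.
have [_|_] := leP `|b y| `|b' y| => /eqP.
  by rewrite abse_eq0 => /eqP; left.
by rewrite abse_eq0 => /eqP; right.
Qed.

Lemma projection_band_lambda (B B' : set V) e e' : is_ideal B -> is_ideal B' ->
  direct_sum B B' -> B e -> B' e' -> vl_one HA = (e + e')%R ->
  lambda A [set y | e y = 1] /\ (forall y, e y = 1 \/ e y = 0).
Proof.
move=> IB IB' BB' Be Be' ee'.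
(* At each point one of [e] and [e'] vanishes and their sum is 1, so [e] is the indicator of a
   clopen set. *)
have dis y : e y = 0 /\ e' y = 1 \/ e y = 1 /\ e' y = 0.
  have eey : (e + e')%R y = 1 by rewrite -ee'.
  have [e0|e0] := direct_sum_vanish y IB IB' BB' Be Be'; [left|right].
    by move: eey; rewrite vl_addE_def e0 ?add0e.
  by move: eey; rewrite vl_addE_def e0 ?adde0 ?fin_num_adde_defl.
have e01 y : e y = 1 \/ e y = 0 by have [[]|[]] := dis y; [right|left].
split => //; have cl (r : R) : closed [set y | e y = r%:E].
  apply: (@closed_comp _ _ e [set r%:E]).
    by move=> y _; exact: dfun_continuous.
  exact/accessible_closed_set1/hausdorff_accessible/ereal_hausdorff.
split.
  split; last exact: cl.
  rewrite (_ : [set y | _] = ~` [set y | e y = 0%:E]).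
    exact/closed_openC/cl.
  apply/seteqP; split => y /=; first by move=> -> /eqP; rewrite onee_eq0.
  by have [|] := e01 y.
(* The component of [a] in [B] is the restriction sought: where [e] is 1 the other component [c']
   vanishes, and where [e'] is 1 [c] itself does. *)
move=> a Aa; have [c [c' [Bc Bc' acc']]] := BB'.1 (VLOf HA Aa).
exists c; first exact: vl_valP.
move=> y; have aE : a y = (c + c')%R y by rewrite -acc'.
case: ifPn => [/set_mem/= ey|/negP ey].
  have c'0 : c' y = 0.
    have [|//] := direct_sum_vanish y IB IB' BB' Be Bc'.
    by rewrite ey => /eqP; rewrite onee_eq0.
  by rewrite aE vl_addE_def c'0 ?adde0// fin_num_adde_defl.
have e'y : e' y = 1.
  by have [[]//|[ey1 _]] := dis y; case: ey; rewrite inE.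
have [//|] := direct_sum_vanish y IB IB' BB' Bc Be'.
by rewrite e'y => /eqP; rewrite onee_eq0.
Qed.

(** The unit vanishes nowhere, so every element of the complement vanishes everywhere. *)
Lemma direct_sum_one (B B' : set V) : is_ideal B -> is_ideal B' ->
  direct_sum B B' -> B (vl_one HA) -> B' `<=` [set 0%R].
Proof.
move=> IB IB' BB' B1 b' Bb'; apply: vl_ext => y.
have [|//] := direct_sum_vanish y IB IB' BB' B1 Bb'.
by move=> /eqP; rewrite onee_eq0.
Qed.

Lemma projection_band_trivial (B : set V) : lambda A = [set set0; setT] ->
  projection_band B <-> B = [set 0%R] \/ B = setT.
Proof.
move=> lA; split; last first.
  move=> [->|->]; split.
  - exact: is_band_set0.
  - by exists setT; split; [exact: is_band_setT|exact: direct_sum0T].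
  - exact: is_band_setT.
  - exists [set 0%R]; split; first exact: is_band_set0.
    exact/direct_sum_sym/direct_sum0T.
move=> [[IB _] [B' [[IB' _] BB']]].
have [e [e' [Be Be' ee']]] := BB'.1 (vl_one HA).
have [] := projection_band_lambda IB IB' BB' Be Be' ee'.
rewrite lA => -[U0|UT] e01; [left|right].
  have e0 : e = 0%R.
    apply: vl_ext => y; have [ey|//] := e01 y.
    by have : [set y | e y = 1] y by []; rewrite U0.
  apply/seteqP; split; last by move=> _ ->; exact: ideal0.
  apply: (direct_sum_one IB' IB); first exact: direct_sum_sym.
  by rewrite ee' e0 add0r.
apply/seteqP; split => // a _; have [b [b' [Bb Bb' ->]]] := BB'.1 a.
rewrite (direct_sum_one IB IB' BB' _ Bb') ?addr0//.
rewrite (_ : vl_one HA = e)//; apply: vl_ext => y.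
by have : [set y | e y = 1] y by rewrite UT.
Qed.

(** If a supremum [x] were positive at a point off [U], it would exceed some [r > 0] on a clopen [W]
    disjoint from [U], and [x] minus [r] times the indicator of [W] would be a smaller upper
    bound. *)
Lemma clopen_band_is_band (U : set Y) : Cfun R Y `<=` A -> clopen_base Y ->
  clopen U -> is_band [set a : V | forall y, ~ U y -> a y = 0].
Proof.
move=> CA ZDY cU; split.
  split => //.
  - by move=> a b a0 b0 y Uy; apply: (idealD (point_ideal_is_ideal HA y));
      [exact: a0 | exact: b0].
  - move=> r a a0 y Uy; apply: (idealZ (point_ideal_is_ideal HA y)).
    exact: a0.
  - move=> a b a0 ab y Uy.
    by apply: (ideal_solid (point_ideal_is_ideal HA y) _ ab); exact: a0.
move=> S x SB [xub xlub] y Uy; apply/le_anti/andP; split; last first.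
  have [[s Ss]|S0] := pselect (S !=set0).
    by rewrite -(SB s Ss y Uy); exact: (vl_leP _ _ (xub s Ss)).
  (* For empty [S] every element is an upper bound, so [x] would be a least element, which is
     impossible. *)
  have : (x <= x - vl_one HA)%R by apply: xlub => s Ss; case: S0; exists s.
  rewrite vl_lesub subrr => /vl_leP/(_ y).
  by rewrite vl_oppE /= lee_fin lerNr oppr0 ler10.
rewrite leNgt; apply/negP => x0.
have [r r0 rx] : exists2 r : R, (0 < r)%R & r%:E < x y.
  case: (x y) x0 => [t| |]//; last by exists 1%R => //; rewrite ltry.
  rewrite lte_fin => t0; exists (t / 2)%R; first by rewrite divr_gt0.
  by rewrite lte_fin ltr_pdivrMr// ltr_pMr// ltr1n.
have [W [cW Wy Wx]] : exists W,
    [/\ clopen W, W y & W `<=` ~` U `&` [set z | r%:E < x z]].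
  apply: (clopen_nbhs ZDY); apply: open_nbhs_nbhs; split => //; apply: openI.
    by apply: closed_openC; case: cU.
  apply: (@open_comp _ _ x [set z | r%:E < z]).
    by move=> z _; exact: dfun_continuous.
  exact: open_ereal_gt_ereal.
have [a aE] := vl_indicator HA CA r cW.
have : (x <= x - a)%R.
  apply: xlub => s Ss; apply/vl_leP => z.
  rewrite vl_addE_def vl_oppE aE; last exact: fin_num_adde_defl.
  case: ifPn => [/set_mem Wz|_].
    have [Uz /ltW rxz] := Wx z Wz.
    by rewrite (SB s Ss z Uz) sube_ge0.
  by rewrite oppe0 adde0; exact: (vl_leP _ _ (xub s Ss)).
rewrite vl_lesub subrr => /vl_leP/(_ y).
by rewrite vl_oppE aE mem_set//= lee_fin lerNr oppr0 leNgt r0.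
Qed.

(** The band of elements vanishing off [U] contains the indicator of [U], so it is nonzero. A
    nonzero projection band inside it would be everything, yet the unit does not vanish at [z]. *)
Lemma not_SMP (U : set Y) x z : Cfun R Y `<=` A -> clopen_base Y ->
  lambda A = [set set0; setT] -> clopen U -> U x -> ~ U z -> ~ SMP V.
Proof.
move=> CA ZDY lA cU Ux Uz smp.
have bB := clopen_band_is_band CA ZDY cU.
have [B0|P [PB P0 PU]] := smp _ bB.
  have [a aE] := vl_indicator HA CA 1 cU.
  have : [set a : V | forall y, ~ U y -> a y = 0] a.
    by move=> y Uy; rewrite aE memNset.
  rewrite B0 /= => /(congr1 (fun a : V => a x)) /eqP.
  by rewrite aE mem_set// onee_eq0.
have [//|PT] := (projection_band_trivial _ lA).1 PB.
have /PU/(_ z Uz)/eqP : P (vl_one HA) by rewrite PT.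
by rewrite onee_eq0.
Qed.

End ClopenBands.

(** * Connectedness of [X] and the computation of [lambda A] *)

Section ConnectedBase.
Context {X Y : topologicalType} {tau : Y -> X}.
Hypothesis Htau : is_cover tau.
Hypothesis connX : connected [set: X].

Lemma cover_closed (F : set Y) : closed F -> closed (tau @` F).
Proof.
move=> cF; apply: (compact_closed (cover_hausdorff_cod Htau)).
apply: continuous_compact.
  by apply: continuous_subspaceT; exact: cover_continuous.
exact: (subclosed_compact cF (cover_compact_dom Htau)).
Qed.

(** Otherwise the closed images of [U] and of its complement would partition [X]; by connectedness
    the image of [U] would be all of [X], leaving nothing for the complement. *)
Lemma fibre_meets_clopen (U : set Y) : clopen U -> U <> set0 -> U <> setT ->
  exists y y', [/\ U y, ~ U y' & tau y = tau y'].
Proof.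
move=> [oU cU] /eqP/set0P[x Ux] UT; apply: contrapT => nfib.
have disj z : (tau @` U) z -> ~ (tau @` (~` U)) z.
  by move=> [y Uy <-] [y' Uy' yy']; apply: nfib; exists y, y'.
have cov z : ~ (tau @` (~` U)) z -> (tau @` U) z.
  have [y <-] := cover_surj Htau z => nU; exists y => //.
  by apply: contrapT => Uy; apply: nU; exists y.
have tUT : tau @` U = setT.
  apply: connX; first by exists (tau x), x.
  - exists (~` (tau @` (~` U))).
      by apply/closed_openC/cover_closed/open_closedC.
    by rewrite setTI; apply/seteqP; split => z; [exact: disj|exact: cov].
  - by exists (tau @` U); [exact: cover_closed|rewrite setTI].
apply: UT; apply/seteqP; split => // y _; apply: contrapT => Uy.
have : (tau @` U) (tau y) by rewrite tUT.
by move=> /disj; apply; exists y.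
Qed.

Context {R : realType} {f : set X -> dfun R X}.
Hypothesis f_ge1 : forall Z, singletons Z -> forall x, (1 <= f Z x)%E.
Hypothesis f_pinfty : forall Z, singletons Z -> f Z @^-1` [set +oo%E] = Z.
Notation A := (A_of Htau (@singletons X) f).

(* A fibre meeting both [U] and its complement forces the coefficient of its
   pole to be both zero and nonzero. *)
Lemma lambda_A_of : lambda A = [set set0; setT].
Proof.
have HA := A_of_vlattice_in f_ge1 f_pinfty Htau.
apply/seteqP; split; last first.
  move=> _ [->|->]; split; [exact: clopen0 | | exact: clopenT |] => a Aa.
    by exists (dcst 0); [exact: vlin0 HA|move=> y; rewrite in_set0].
  by exists a => // y; rewrite in_setT.
move=> U [cU UA]; apply: contrapT => /not_orP[U0 UT].
have [y [y' [Uy Uy' yy']]] := fibre_meets_clopen cU U0 UT.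
have s1 : all_singletons [:: [set tau y]].
  by move=> Z; rewrite inE => /eqP->; exists (tau y).
have [h [Ah hE]] : exists h : dfun R Y, A h /\
    represents (f := f) (tau := tau) (fun=> 0) (fun=> 1) [:: [set tau y]] h.
  by apply: represented_A_of => // z; exact: cvg_cst.
have hy : h y \isn't a fin_num.
  have us : uniq [:: [set tau y]] by [].
  apply: (represents_pole f_pinfty us s1 hE (mem_head _ _)) => //.
  exact/eqP/oner_neq0.
have [b Ab bE] := UA _ Ah.
have [g [c [s [_ us sS bgc]]]] := A_of_represented f_ge1 f_pinfty Ab.
(* [b] agrees with [h] at [y] and is infinite there, so some pole over [y] has a nonzero
   coefficient; it lies over [y'] as well, where [b] is 0. *)
have [W [Ws Wy cW]] : exists W, [/\ W \in s, W (tau y) & c W <> 0].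
  apply: contrapT => nW; move: hy; apply/negP; rewrite negbK.
  have <- : b y = h y by rewrite bE mem_set.
  apply: (represents_fin_num f_ge1 f_pinfty sS bgc) => W Ws Wy.
  by apply: contrapT => cW; apply: nW; exists W.
rewrite yy' in Wy.
have := represents_pole f_pinfty us sS bgc Ws Wy cW.
by rewrite bE memNset.
Qed.

End ConnectedBase.

(** * Points of [X] as nowhere dense zero-sets, and the final assembly *)

Lemma connected_nowhere_dense_set1 (X : topologicalType) (p q : X) :
  hausdorff_space X -> connected [set: X] -> p <> q -> nowhere_dense [set p].
Proof.
move=> hX connX pq.
have cp : closed [set p].
  exact/accessible_closed_set1/hausdorff_accessible.
rewrite /nowhere_dense -(closure_id _).1//.
apply/seteqP; split => // x ix; have xp : x = p := interior_subset ix.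
(* An interior point makes the closed set [[set p]] open too, so connectedness would make it all of
   [X]. *)
suff : [set p] = setT by move=> pT; apply: pq; have : [set p] q by rewrite pT.
apply: connX; first by exists p.
  exists (interior [set p]); first exact: open_interior.
  rewrite setTI; apply/seteqP; split => z; last exact: interior_subset.
  by move=> ->; rewrite -[X in _ X]xp.
by exists [set p] => //; rewrite setTI.
Qed.

Lemma dfun_pole_zero_set (R : realType) (X : topologicalType) (f : dfun R X)
  (S : set X) : f @^-1` [set +oo%E] = S -> zero_set R S.
Proof.
(* [contract] is real-valued and takes the value 1 only at [+oo]. *)
move=> <-; exists (fun x => 1 - contract (f x)).
  move=> x; apply: cvgB; first exact: cvg_cst.
  exact: continuous_comp (@dfun_continuous _ _ f x) (@contract_continuous R _).
apply/seteqP; split => x /=; first by move=> ->; rewrite /= subrr.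
by move=> /eqP; rewrite subr_eq0 eq_sym contract_eq1 => /eqP.
Qed.

Theorem theorem8p3 (R : realType) (X Y : topologicalType)
    (cX : compact [set: X]) (hX : hausdorff_space X)
    (connX : connected [set: X]) (X_gt1 : exists p q : X, p <> q)
    (GX : forall p : X, Gdelta [set p])
    (f : set X -> dfun R X)
    (f_ge1 : forall Z, singletons Z -> forall x, (1 <= f Z x)%E)
    (f_pinfty : forall Z, singletons Z -> f Z @^-1` [set +oo%E] = Z)
    (tau : Y -> X) (Htau : is_cover tau) (ZDY : clopen_base Y) :
  (forall p : X, nowhere_dense [set p] /\ zero_set R [set p]) /\
  let A := A_of Htau (@singletons X) f in
  exists HA : vlattice_in A,
    [/\ archimedean_vl (vl_of HA) /\ weak_order_unit (vl_one HA),
        yosida_space_is HA /\ clopen_base (yosida (vl_one HA)),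
        lambda A = [set set0; setT],
        (forall B : set (vl_of HA),
           projection_band B <-> B = [set 0] \/ B = setT) &
        ~ SMP (vl_of HA)].
Proof.
split.
  move=> p; split; last first.
    by apply: (dfun_pole_zero_set (f := f [set p])); apply: f_pinfty; exists p.
  have [x [z xz]] := X_gt1; have [px|px] := pselect (p = x).
    by apply: (connected_nowhere_dense_set1 (q := z)) => //; rewrite px.
  exact: (connected_nowhere_dense_set1 (q := x)).
move=> A; have HA := A_of_vlattice_in f_ge1 f_pinfty Htau.
have CA : Cfun R Y `<=` A := Cfun_A_of f_ge1 f_pinfty Htau.
have cY := cover_compact_dom Htau; have hY := cover_hausdorff_dom Htau.
have lA : lambda A = [set set0; setT].
  exact: lambda_A_of.
have [p [q pq]] := X_gt1.
(* Points over [p] and [q] are distinct, which gives the nontrivial clopen set that refutes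
   [SMP]. *)
have [[y yp] [z zq]] := (cover_surj Htau p, cover_surj Htau q).
have yz : y <> z by move=> yz; apply: pq; rewrite -yp yz.
have [U [cU Uy Uz]] := clopen_separate_points hY ZDY yz.
exists HA; split => //.
- by split; [exact: vl_of_archimedean|exact: vl_of_weak_order_unit].
- split; first exact: vlattice_yosida_space_is.
  exact: yosida_clopen_base.
- by move=> B; exact: projection_band_trivial.
- exact: (not_SMP CA ZDY lA cU Uy Uz).
Qed.
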